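(* There exists an absolute constant $c>0$ such that the following holds. Let $$n=\sum_{i=1}^{s}\sum_{k=l_i}^{t_i}2^k,$$ where $s\ge1$ and $l_i,t_i$ are non-negative integers with $t_i\ge l_i$ for $1\le i\le s$ and $l_i-2\ge t_{i+1}$ for $1\le i<s$ (so $t_1\ge l_1>l_1-2\ge t_2\ge l_2>l_2-2\ge\dots\ge t_s\ge l_s\ge0$). Then, pointwise on $G$, $$|nK_n|\le c\sum_{A=1}^{s}\left(2^{l_A}K_{2^{l_A}}+2^{t_A}K_{2^{t_A}}+2^{l_A}\sum_{k=l_A}^{t_A}D_{2^k}\right).$$
   Context: $G=\prod_{j=0}^\infty Z_2$, where $Z_2=\{0,1\}$ is the cyclic group of order 2; elements are $x=(x_0,x_1,\dots)$. Walsh system: $r_k(x)=(-1)^{x_k}$; for $m=\sum_j m_j2^j$ with $m_j\in\{0,1\}$, $w_m(x)=\prod_{k=0}^\infty r_k(x)^{m_k}$. Dirichlet and Fejér kernels: $D_n=\sum_{k=0}^{n-1}w_k$ and $K_n=\frac1n\sum_{k=1}^nD_k$ for $n\ge1$. *)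

(* Defs.v *)
From HB Require Import structures.
From mathcomp Require Import all_boot all_order all_algebra.
From mathcomp Require Import reals.

Set Implicit Arguments.
Unset Strict Implicit.
Unset Printing Implicit Defensive.

Import Order.TTheory GRing.Theory Num.Theory.
Local Open Scope ring_scope.

Definition walsh_group : Type := nat -> 'Z_2.

Definition bin_digit (m k : nat) : nat := ((m %/ 2 ^ k) %% 2)%N.

Definition rademacher (R : realType) (k : nat) (x : walsh_group) : R :=
  (-1) ^+ (x k : nat).

(* The factors of index k >= m of the infinite product are all equal to 1,
   because m < 2 ^ m; see [walshE]. *)
Definition walsh (R : realType) (m : nat) (x : walsh_group) : R :=
  \prod_(0 <= k < m) rademacher R k x ^+ bin_digit m k.

Lemma bin_digit_large (m k : nat) : (m <= k)%N -> bin_digit m k = 0%N.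
Proof.
move=> lemk; rewrite /bin_digit divn_small //.
exact: leq_ltn_trans lemk (ltn_expl _ _).
Qed.

Lemma walshE (R : realType) (m N : nat) (x : walsh_group) : (m <= N)%N ->
  walsh R m x = \prod_(0 <= k < N) rademacher R k x ^+ bin_digit m k.
Proof.
move=> lemN; rewrite (@big_cat_nat _ _ _ m) //= [X in _ * X]big_nat.
by rewrite [X in _ * X]big1 ?mulr1 // => k /andP[/bin_digit_large-> _].
Qed.

Definition dirichlet (R : realType) (n : nat) (x : walsh_group) : R :=
  \sum_(0 <= k < n) walsh R k x.

Definition fejer (R : realType) (n : nat) (x : walsh_group) : R :=
  n%:R^-1 * \sum_(1 <= k < n.+1) dirichlet R k x.

(* Main.v *)
(** Write F_n = n K_n = D_1 + ... + D_n. If 2^a divides B and m <= 2^a, then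
    F_(B+m) = F_B + m D_B + w_B F_m, so the blocks of n can be peeled off one at
    a time. For a block B = 2^T - 2^l with T = t + 1, the reflection
    w_(2^T-1-j) = w_(2^T-1) w_j gives
      F_B = F_(2^T) - 2^l D_(2^T) + w_(2^T-1) (F_(2^l) - D_(2^l)),
    so no intermediate kernel K_(2^k) with l < k < t appears. *)
Require Import Defs.
From HB Require Import structures.
From mathcomp Require Import all_boot all_order all_algebra.
From mathcomp Require Import reals.
From mathcomp Require Import zify ring lra.

Set Implicit Arguments.
Unset Strict Implicit.
Unset Printing Implicit Defensive.

Import Order.TTheory GRing.Theory Num.Theory.
Local Open Scope ring_scope.

(** * Binary digits and Walsh functions *)

Lemma bin_digit_add (a q j k : nat) : (j < 2 ^ a)%N ->
  bin_digit (q * 2 ^ a + j) k = (bin_digit (q * 2 ^ a) k + bin_digit j k)%N.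
Proof.
(* No carry occurs: below position [a] the multiple of [2 ^ a] has only zero digits, and from [a] on
   [j] has only zero digits. *)
move=> ltj; rewrite /bin_digit; have [ltka|leak] := ltnP k a.
  have -> : (2 ^ a = 2 ^ (a - k.+1) * 2 * 2 ^ k)%N.
    by rewrite -expnSr -expnD; congr (2 ^ _)%N; lia.
  by rewrite !mulnA divnMDl ?expn_gt0 // mulnK ?expn_gt0 // modnMDl modnMl.
rewrite [in RHS](@divn_small j) ?mod0n ?addn0; last first.
  by apply: (leq_trans ltj); rewrite leq_exp2l.
have -> : k = (a + (k - a))%N by lia.
by rewrite expnD !divnMA divnMDl ?expn_gt0 // mulnK ?expn_gt0 // (divn_small ltj) addn0.
Qed.

Section WalshKernels.
Variables (R : realType) (x : walsh_group).

Local Notation w m := (walsh R m x).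
Local Notation D m := (dirichlet R m x).
Local Notation r k := (rademacher R k x).

Lemma walsh_add (a q j : nat) : (j < 2 ^ a)%N ->
  w (q * 2 ^ a + j)%N = w (q * 2 ^ a)%N * w j.
Proof.
move=> ltj; set N := (q * 2 ^ a + j)%N.
rewrite (@walshE R (q * 2 ^ a) N) ?leq_addr // (@walshE R j N) ?leq_addl //.
rewrite -big_split /=; apply: eq_bigr => k _.
by rewrite -exprD -bin_digit_add.
Qed.

Lemma walsh_exp2 (a : nat) : w (2 ^ a)%N = r a.
Proof.
have lta : (a < 2 ^ a)%N by exact: ltn_expl.
rewrite /walsh big_mkord (bigD1 (Ordinal lta)) //= big1 ?mulr1.
  by rewrite /bin_digit divnn expn_gt0.
move=> [k ltk] /=; rewrite -val_eqE /= => neqk {ltk}.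
rewrite /bin_digit; have [ltka|leak] := ltnP k a.
  have -> : (2 ^ a = 2 ^ (a - k.+1) * 2 * 2 ^ k)%N.
    by rewrite -expnSr -expnD; congr (2 ^ _)%N; lia.
  by rewrite mulnK ?expn_gt0 // modnMl.
by rewrite divn_small // ltn_exp2l //; lia.
Qed.

Lemma walsh_exp2_add (a j : nat) : (j < 2 ^ a)%N -> w (2 ^ a + j)%N = r a * w j.
Proof. by move=> /(walsh_add 1); rewrite !mul1n walsh_exp2. Qed.

Lemma rademacher_sqr (k : nat) : r k * r k = 1.
Proof. by rewrite /rademacher -exprMn mulrNN mulr1 expr1n. Qed.

Lemma normr_rademacher (k : nat) : `|r k| = 1.
Proof. by rewrite /rademacher normrX normrN1 expr1n. Qed.

Lemma normr_walsh (m : nat) : `|w m| = 1.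
Proof.
rewrite /walsh normr_prod big1 // => k _.
by rewrite normrX normr_rademacher expr1n.
Qed.

(** Passing from [j] to [2 ^ T - 1 - j] flips the [T] lowest digits, and flipping a digit multiplies
    by the corresponding Rademacher function because its square is 1. The induction treats the top
    digit. *)
Lemma walsh_reflect (T j : nat) : (j < 2 ^ T)%N ->
  w (2 ^ T - 1 - j)%N = w (2 ^ T - 1)%N * w j.
Proof.
elim: T j => [|T IH] j.
  by case: j => // _; rewrite /walsh !big_geq // mulr1.
rewrite expnS mul2n -addnn => ltj; have gt0 : (0 < 2 ^ T)%N by rewrite expn_gt0.
have -> : (2 ^ T + 2 ^ T - 1 = 2 ^ T + (2 ^ T - 1))%N by lia.
rewrite walsh_exp2_add; last by lia.
have [ltjT|leTj] := ltnP j (2 ^ T).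
  by rewrite -addnBA ?walsh_exp2_add ?IH ?mulrA //; lia.
(* Here the top digit of [j] is set, so the reflected index lies below [2 ^ T]; on the right the two
   factors [r T] cancel. *)
have /subnKC <- := leTj; set i := (j - 2 ^ T)%N.
have lti : (i < 2 ^ T)%N by rewrite /i; lia.
by rewrite subnDl IH // walsh_exp2_add // mulrACA rademacher_sqr mul1r.
Qed.

(** * Dirichlet kernels *)

Lemma dirichlet0 : D 0 = 0.
Proof. by rewrite /dirichlet big_geq. Qed.

Lemma dirichletS (m : nat) : D m.+1 = D m + w m.
Proof. by rewrite /dirichlet big_nat_recr. Qed.

Lemma dirichlet_add (a q j : nat) : (j <= 2 ^ a)%N ->
  D (q * 2 ^ a + j)%N = D (q * 2 ^ a)%N + w (q * 2 ^ a)%N * D j.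
Proof.
move=> lej; rewrite /dirichlet (@big_cat_nat _ _ _ (q * 2 ^ a)) ?leq_addr //=.
congr (_ + _); rewrite -{1}[(q * 2 ^ a)%N]add0n big_addn addKn mulr_sumr.
rewrite [LHS]big_nat [RHS]big_nat; apply: eq_bigr => i /andP[_ lti].
by rewrite addnC walsh_add //; exact: leq_trans lej.
Qed.

Lemma dirichlet_reflect (T j : nat) : (j <= 2 ^ T)%N ->
  D (2 ^ T - j)%N = D (2 ^ T)%N - w (2 ^ T - 1)%N * D j.
Proof.
elim: j => [|j IH] ltj; first by rewrite subn0 dirichlet0 mulr0 subr0.
have := IH (ltnW ltj).
have -> : (2 ^ T - j = (2 ^ T - j.+1).+1)%N by lia.
rewrite !dirichletS; have -> : (2 ^ T - j.+1 = 2 ^ T - 1 - j)%N by lia.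
by rewrite walsh_reflect // => /(canRL (addrK _)) ->; ring.
Qed.

Lemma dirichlet_exp2S (k : nat) : D (2 ^ k.+1)%N = (1 + r k) * D (2 ^ k)%N.
Proof.
have := @dirichlet_add k 1 (2 ^ k) (leqnn _).
by rewrite !mul1n addnn -mul2n -expnS walsh_exp2 => ->; ring.
Qed.

Lemma rademacher_bounds (k : nat) : -1 <= r k <= 1.
Proof. by rewrite -ler_norml normr_rademacher. Qed.

Lemma dirichlet_exp2_ge0 (k : nat) : 0 <= D (2 ^ k)%N.
Proof.
elim: k => [|k IH]; first by rewrite /dirichlet big_nat1 /walsh big_geq.
by rewrite dirichlet_exp2S mulr_ge0 //; have := rademacher_bounds k; lra.
Qed.

(** * Unnormalised Fejér kernels *)

Definition fejer_sum (n : nat) : R := \sum_(0 <= k < n) D k.+1.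

Local Notation F := fejer_sum.

Lemma fejer_sumE (n : nat) : n%:R * fejer R n x = F n.
Proof.
rewrite /fejer /fejer_sum big_add1; case: n => [|n]; first by rewrite mul0r big_geq.
by rewrite mulrA divff ?mul1r // pnatr_eq0.
Qed.

Lemma fejer_sumS (n : nat) : F n.+1 = F n + D n.+1.
Proof. by rewrite /fejer_sum big_nat_recr. Qed.

Lemma fejer_sum0 : F 0 = 0.
Proof. by rewrite /fejer_sum big_geq. Qed.

Lemma fejer_sum_add (a q m : nat) : (m <= 2 ^ a)%N ->
  F (q * 2 ^ a + m)%N
  = F (q * 2 ^ a)%N + m%:R * D (q * 2 ^ a)%N + w (q * 2 ^ a)%N * F m.
Proof.
elim: m => [|m IH] lem; first by rewrite addn0 fejer_sum0; ring.
rewrite addnS !fejer_sumS IH ?(ltnW lem) // -addnS dirichlet_add // -natr1.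
by ring.
Qed.

(** The terms removed from F_(2^T) are D_(2^T-i) for 0 <= i < m. Each is rewritten by
    [dirichlet_reflect], and D_0 + ... + D_(m-1) = F_m - D_m. *)
Lemma fejer_sum_reflect (T m : nat) : (m <= 2 ^ T)%N ->
  F (2 ^ T - m)%N
  = F (2 ^ T)%N - m%:R * D (2 ^ T)%N + w (2 ^ T - 1)%N * (F m - D m).
Proof.
elim: m => [|m IH] lem.
  by rewrite subn0 fejer_sum0 dirichlet0; ring.
have := IH (ltnW lem).
have -> : (2 ^ T - m = (2 ^ T - m.+1).+1)%N by lia.
rewrite fejer_sumS; have -> : ((2 ^ T - m.+1).+1 = 2 ^ T - m)%N by lia.
rewrite dirichlet_reflect ?(ltnW lem) // fejer_sumS -natr1.
by move=> /(canRL (addrK _)) ->; ring.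
Qed.

Lemma fejer_sum_exp2S (k : nat) :
  F (2 ^ k.+1)%N = (1 + r k) * F (2 ^ k)%N + (2 ^ k)%N%:R * D (2 ^ k)%N.
Proof.
have := @fejer_sum_add k 1 (2 ^ k) (leqnn _).
by rewrite !mul1n addnn -mul2n -expnS walsh_exp2 => ->; ring.
Qed.

(** This absorbs the Dirichlet terms left by doubling and reflection into F_(2^k). With u = 2^k
    D_(2^k) and v = F_(2^k), the induction step reduces to r u <= (1 + r) v, which follows from u <=
    2 v, u >= 0 and -1 <= r <= 1. *)
Lemma dirichlet_le_fejer_sum (k : nat) :
  (2 ^ k)%N%:R * D (2 ^ k)%N <= 2 * F (2 ^ k)%N.
Proof.
elim: k => [|k IH].
  rewrite fejer_sumS fejer_sum0; have := dirichlet_exp2_ge0 0; rewrite expn0; lra.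
rewrite fejer_sum_exp2S dirichlet_exp2S expnS natrM.
have /andP[r1 r2] := rademacher_bounds k.
have c0 : 0 <= (2 ^ k)%N%:R * D (2 ^ k)%N.
  by rewrite mulr_ge0 ?ler0n ?dirichlet_exp2_ge0.
move: IH c0; set u := _ * D _; set v := F _ => IH c0.
rewrite (_ : 2%:R * _ * _ = 2 * (1 + r k) * u); last by rewrite /u; ring.
nra.
Qed.

Lemma fejer_sum_exp2_ge0 (k : nat) : 0 <= F (2 ^ k)%N.
Proof.
have := dirichlet_le_fejer_sum k.
have : 0 <= (2 ^ k)%N%:R * D (2 ^ k)%N.
  by rewrite mulr_ge0 ?ler0n ?dirichlet_exp2_ge0.
lra.
Qed.

(** * Estimate for a single block *)

Definition block_bound (l t : nat) : R :=
  F (2 ^ l)%N + F (2 ^ t)%N + (2 ^ l)%N%:R * \sum_(l <= k < t.+1) D (2 ^ k)%N.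

Lemma fejer_sum_block (l t m : nat) : (l <= t)%N -> (m <= 2 ^ l)%N ->
  `|F (2 ^ t.+1 - 2 ^ l + m)%N| <= 5 * block_bound l t + `|F m|.
Proof.
(* The block is q 2^l, so a tail of size at most 2^l splits off by [fejer_sum_add]; the block itself
   is then reflected in 2^(t+1). *)
move=> lelt lem; set q := (2 ^ (t.+1 - l) - 1)%N.
have lelT : (2 ^ l <= 2 ^ t.+1)%N by rewrite leq_exp2l // ltnW.
have Bq : (q * 2 ^ l = 2 ^ t.+1 - 2 ^ l)%N.
  by rewrite /q mulnBl mul1n -expnD subnK // ltnW.
rewrite -Bq fejer_sum_add // Bq.
rewrite fejer_sum_reflect // dirichlet_reflect //.
set S := \sum_(l <= k < t.+1) D (2 ^ k)%N.
have DtS : D (2 ^ t)%N <= S.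
  rewrite /S big_nat_recr //= lerDr.
  by apply: sumr_ge0 => k _; exact: dirichlet_exp2_ge0.
have DlS : D (2 ^ l)%N <= S.
  rewrite /S big_ltn //= lerDl.
  by apply: sumr_ge0 => k _; exact: dirichlet_exp2_ge0.
have Dt0 := dirichlet_exp2_ge0 t; have Dl0 := dirichlet_exp2_ge0 l.
have DT0 := dirichlet_exp2_ge0 t.+1; have FT0 := fejer_sum_exp2_ge0 t.+1.
have Fl0 := fejer_sum_exp2_ge0 l; have Ft0 := fejer_sum_exp2_ge0 t.
have /andP[r1 r2] := rademacher_bounds t.
(* Reflection produces kernels at 2^(t+1), while the bound only has 2^t; one doubling step costs a
   factor 2 for D and 4 for F. *)
have DTt : D (2 ^ t.+1)%N <= 2 * D (2 ^ t)%N by rewrite dirichlet_exp2S; nra.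
have FTt : F (2 ^ t.+1)%N <= 4 * F (2 ^ t)%N.
  by rewrite fejer_sum_exp2S; have := dirichlet_le_fejer_sum t; nra.
have DlF : D (2 ^ l)%N <= 2 * F (2 ^ l)%N.
  apply: le_trans (dirichlet_le_fejer_sum l).
  by rewrite ler_peMl // ler1n expn_gt0.
have mB : m%:R <= (2 ^ l)%N%:R :> R by rewrite ler_nat.
have m0 : 0 <= m%:R :> R by rewrite ler0n.
have FlD : `|F (2 ^ l)%N - D (2 ^ l)%N| <= 3 * F (2 ^ l)%N.
  by rewrite ler_norml; lra.
have DB : `|D (2 ^ t.+1)%N - w (2 ^ t.+1 - 1)%N * D (2 ^ l)%N| <= 3 * S.
  apply: (le_trans (ler_normB _ _)); rewrite normrM normr_walsh mul1r.
  by rewrite !ger0_norm //; lra.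
apply: (le_trans (ler_normD _ _)); rewrite [`|w _ * _|]normrM normr_walsh mul1r.
rewrite lerD2r; apply: (le_trans (ler_normD _ _)).
rewrite [`|m%:R * _|]normrM [`|m%:R|]ger0_norm //.
have H1 : m%:R * `|D (2 ^ t.+1)%N - w (2 ^ t.+1 - 1)%N * D (2 ^ l)%N|
    <= (2 ^ l)%N%:R * (3 * S) by rewrite ler_pM.
have H2 : (2 ^ l)%N%:R * D (2 ^ t.+1)%N <= (2 ^ l)%N%:R * (2 * S).
  by rewrite ler_wpM2l ?ler0n //; lra.
have H3 : 0 <= (2 ^ l)%N%:R * D (2 ^ t.+1)%N by rewrite mulr_ge0.
have H4 : `|F (2 ^ t.+1)%N - (2 ^ l)%N%:R * D (2 ^ t.+1)%N
    + w (2 ^ t.+1 - 1)%N * (F (2 ^ l)%N - D (2 ^ l)%N)|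
    <= 4 * F (2 ^ t)%N + (2 ^ l)%N%:R * (2 * S) + 3 * F (2 ^ l)%N.
  apply: (le_trans (ler_normD _ _)); rewrite [`|w _ * _|]normrM normr_walsh mul1r.
  apply: lerD => //; apply: (le_trans (ler_normB _ _)).
  by rewrite !ger0_norm //; exact: lerD.
rewrite [(2 ^ l)%N%:R * (3 * S)]mulrCA in H1.
rewrite [(2 ^ l)%N%:R * (2 * S)]mulrCA in H4.
rewrite /block_bound -/S.
(* The coefficients are 3 for F_(2^l), 4 for F_(2^t), and 2 + 3 = 5 for 2^l S, the 3 coming from m
   D_B; hence the constant 5. *)
lra.
Qed.

End WalshKernels.

(** * Summation over the blocks *)

Lemma sum_exp2_block (l t : nat) :
  (\sum_(l <= k < t.+1) 2 ^ k = 2 ^ t.+1 - 2 ^ l)%N.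
Proof.
transitivity (\sum_(l <= k < t.+1) (2 ^ k.+1 - 2 ^ k))%N.
  by apply: eq_bigr => k _; rewrite expnS mul2n -addnn addnK.
by apply: telescope_sumn => i j leij; rewrite leq_exp2l.
Qed.

(** Induction on the number of blocks, removing the leading one and shifting the indices. The size
    bound on n is carried along because the tail must be at most 2^(l_1) for [fejer_sum_block] to
    apply. *)
Lemma fejer_sum_blocks (R : realType) (x : walsh_group) (s : nat)
    (l t : nat -> nat) :
  (forall i, (1 <= i <= s)%N -> (l i <= t i)%N) ->
  (forall i, (1 <= i < s)%N -> (t i.+1 + 2 <= l i)%N) ->
  let n := (\sum_(1 <= i < s.+1) \sum_(l i <= k < (t i).+1) 2 ^ k)%N in
  ((0 < s)%N -> (n <= 2 ^ (t 1).+1)%N) /\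
  `|fejer_sum R x n| <= 5 * \sum_(1 <= A < s.+1) block_bound R x (l A) (t A).
Proof.
elim: s l t => [|s IH] l t lelt gap n.
  by rewrite /n !big_geq // fejer_sum0 normr0 mulr0.
have [|i ?|] := IH (l \o S) (t \o S).
- by move=> i lei; apply: lelt; lia.
- by apply: gap; lia.
rewrite /= => ubm bdm.
have lelt1 : (l 1 <= t 1)%N by exact: lelt.
set m := (\sum_(1 <= i < s.+1) _)%N in ubm bdm.
have nE : n = (2 ^ (t 1).+1 - 2 ^ l 1 + m)%N.
  by rewrite /n big_ltn // big_add1 /= sum_exp2_block.
have lem : (m <= 2 ^ l 1)%N.
  (* A nonempty tail is at most 2^(t_2+1), and the gap condition places t_2 + 1 below l_1. *)
  have [s0|s_gt0] := posnP s; first by rewrite /m s0 big_geq.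
  apply: (leq_trans (ubm s_gt0)); rewrite leq_exp2l //.
  by have := gap 1%N s_gt0; lia.
have lelT : (2 ^ l 1 <= 2 ^ (t 1).+1)%N by rewrite leq_exp2l // ltnW.
split=> [_|]; first by rewrite nE; lia.
rewrite nE big_ltn // mulrDr big_add1 /=.
by apply: (le_trans (fejer_sum_block _ _ lelt1 lem)); rewrite lerD2l.
Qed.

Theorem proposition2 (R : realType) :
  exists c : R, 0 < c /\
    forall (s : nat) (l t : nat -> nat) (n : nat),
      (1 <= s)%N ->
      (forall i : nat, (1 <= i <= s)%N -> (l i <= t i)%N) ->
      (forall i : nat, (1 <= i < s)%N -> (t i.+1 + 2 <= l i)%N) ->
      n = (\sum_(1 <= i < s.+1) \sum_(l i <= k < (t i).+1) 2 ^ k)%N ->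
      forall x : walsh_group,
        `|n%:R * fejer R n x| <=
          c * \sum_(1 <= A < s.+1)
                ((2 ^ l A)%N%:R * fejer R (2 ^ l A) x
                 + (2 ^ t A)%N%:R * fejer R (2 ^ t A) x
                 + (2 ^ l A)%N%:R *
                     \sum_(l A <= k < (t A).+1) dirichlet R (2 ^ k) x).
Proof.
exists 5; split=> // s l t n _ lelt gap -> x; rewrite fejer_sumE.
have [_ bound] := fejer_sum_blocks R x lelt gap.
apply: (le_trans bound); rewrite le_eqVlt; apply/orP; left; apply/eqP.
by congr (5 * _); apply: eq_bigr => A _; rewrite !fejer_sumE.
Qed.
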